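(* Let $\mathcal{P}\subseteq\mathbb{R}^D$ have linear span equal to $\mathbb{R}^D$ and let $\Sigma=(r,m,n,\mathcal{P},\{(A_q,B_q,C_q)\}_{q=1}^D)$ be an ALPV of dimension $n\ge 1$. Then $\Sigma$ is reachable if and only if $\mathrm{rank}\,\mathcal{R}_{n-1}=n$, and $\Sigma$ is observable if and only if $\mathrm{rank}\,\mathcal{O}_{n-1}=n$, where $\mathcal{R}_{i}$ and $\mathcal{O}_i$ are the extended reachability and observability matrices of $\Sigma$.
   Context: Fix positive integers $D,m,r$, put $Q=\{1,\dots,D\}$. For a set $X$, $X^+$ denotes the set of finite non-empty sequences of elements of $X$. For $\mathcal{P}\subseteq\mathbb{R}^D$ (scheduling space), a discrete-time affine LPV system (ALPV) $\Sigma=(r,m,n,\mathcal{P},\{(A_q,B_q,C_q)\}_{q=1}^D)$ has matrices $A_q\in\mathbb{R}^{n\times n}$, $B_q\in\mathbb{R}^{n\times m}$, $C_q\in\mathbb{R}^{r\times n}$, $q\in Q$, and dynamics $$x(t+1)=\sum_{q=1}^D (A_qx(t)+B_qu(t))p_q(t),\qquad y(t)=\sum_{q=1}^D C_qx(t)p_q(t),$$ with $p(t)=(p_1(t),\dots,p_D(t))\in\mathcal{P}$, $u(t)\in\mathbb{R}^m$. Let $\mathcal{U}=\mathcal{P}\times\mathbb{R}^m$. For $x\in\mathbb{R}^n$ and $w=(p(0),u(0))\cdots(p(t),u(t))\in\mathcal{U}^+$, $x_{\Sigma,x}(w)$ and $y_{\Sigma,x}(w)$ denote the state $x(t)$ and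 output $y(t)$ at time $t$ when $x(0)=x$ and the scheduling values and inputs in $w$ are applied. $\Sigma$ is reachable if $\{x_{\Sigma,0}(w): w\in\mathcal{U}^+\}$ spans $\mathbb{R}^n$; observable if, for $x_1,x_2\in\mathbb{R}^n$, $y_{\Sigma,x_1}=y_{\Sigma,x_2}$ (as maps on $\mathcal{U}^+$) implies $x_1=x_2$. Extended reachability matrices: $\mathcal{R}_0=\begin{bmatrix}B_1 & B_2&\cdots& B_D\end{bmatrix}$ and $\mathcal{R}_{i+1}=\begin{bmatrix}\mathcal{R}_i & A_1\mathcal{R}_i & A_2\mathcal{R}_i&\cdots & A_D\mathcal{R}_i\end{bmatrix}$ for $i=0,1,2,\dots$. Extended observability matrices: $\mathcal{O}_0=\begin{bmatrix}C_1^T & C_2^T&\cdots& C_D^T\end{bmatrix}^T$ and $\mathcal{O}_{i+1}=\begin{bmatrix}\mathcal{O}_i^T & A_1^T\mathcal{O}_i^T & A_2^T\mathcal{O}_i^T&\cdots & A_D^T\mathcal{O}_i^T\end{bmatrix}^T$ for $i=0,1,2,\dots$. *)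

(* Defs.v *)
From mathcomp Require Export all_boot all_order all_algebra.
From mathcomp Require Export classical_sets reals.

Set Implicit Arguments.
Unset Strict Implicit.
Unset Printing Implicit Defensive.

Import GRing.Theory.

Local Open Scope classical_set_scope.
Local Open Scope ring_scope.

Definition lin_span (F : fieldType) (V : lmodType F) (S : set V) : set V :=
  [set v | exists2 c : seq (F * V),
     (forall a, a \in c -> S a.2) & v = \sum_(a <- c) a.1 *: a.2].

(* The set X^+ of finite non-empty sequences of elements of X. *)
Definition words (T : eqType) (X : set T) : set (seq T) :=
  [set w | w <> [::] /\ (forall a, a \in w -> X a)].

(* r outputs, m inputs, state dimension n, D scheduling components;
   the index set Q = {1, ..., D} is rendered as 'I_D. *)
Record alpv (R : realType) (D r m n : nat) := Alpv {
  sched : set 'cV[R]_D ;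
  Amx : 'I_D -> 'M[R]_n ;
  Bmx : 'I_D -> 'M[R]_(n, m) ;
  Cmx : 'I_D -> 'M[R]_(r, n)
}.

Section ALPV.
Variables (R : realType) (D r m n : nat) (Sg : alpv R D r m n).

Definition input_space : set ('cV[R]_D * 'cV[R]_m) := sched Sg `*` setT.

Fixpoint traj (p : nat -> 'cV[R]_D) (u : nat -> 'cV[R]_m) (x : 'cV[R]_n)
    (t : nat) : 'cV[R]_n :=
  if t is s.+1 then
    \sum_(q < D) p s q 0 *: (Amx Sg q *m traj p u x s + Bmx Sg q *m u s)
  else x.

Definition sched_of (w : seq ('cV[R]_D * 'cV[R]_m)) (t : nat) : 'cV[R]_D :=
  (nth (0, 0) w t).1.
Definition input_of (w : seq ('cV[R]_D * 'cV[R]_m)) (t : nat) : 'cV[R]_m :=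
  (nth (0, 0) w t).2.

(* A word of size t + 1 is mapped to the state and the output at time t; the
   last letter thus enters the output (through p(t)) but not the state. *)
Definition state_map (x : 'cV[R]_n) (w : seq ('cV[R]_D * 'cV[R]_m)) :
    'cV[R]_n :=
  traj (sched_of w) (input_of w) x (size w).-1.

Definition output_map (x : 'cV[R]_n) (w : seq ('cV[R]_D * 'cV[R]_m)) :
    'cV[R]_r :=
  \sum_(q < D) sched_of w (size w).-1 q 0 *: (Cmx Sg q *m state_map x w).

Definition reachable : Prop :=
  lin_span (state_map 0 @` words input_space) = setT.

Definition observable : Prop :=
  forall x1 x2 : 'cV[R]_n,
    (forall w, words input_space w -> output_map x1 w = output_map x2 w) ->
    x1 = x2.

(* Number of columns of the i-th extended reachability matrix (k = m), and of
   rows of the i-th extended observability matrix (k = r). *)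
Fixpoint ext_size (k i : nat) : nat :=
  if i is j.+1 then (ext_size k j + \sum_(q < D) ext_size k j)%N
  else (\sum_(q < D) k)%N.

Fixpoint reach_mx (i : nat) : 'M[R]_(n, ext_size m i) :=
  if i is j.+1 then
    row_mx (reach_mx j) (\mxrow_(q < D) (Amx Sg q *m reach_mx j))
  else \mxrow_(q < D) Bmx Sg q.

Fixpoint obs_mx (i : nat) : 'M[R]_(ext_size r i, n) :=
  if i is j.+1 then
    (row_mx (obs_mx j)^T (\mxrow_(q < D) ((Amx Sg q)^T *m (obs_mx j)^T)))^T
  else (\mxrow_(q < D) (Cmx Sg q)^T)^T.

End ALPV.

(* Main.v *)
Require Import Defs.
From mathcomp Require Import all_boot all_order all_algebra.
From mathcomp Require Import classical_sets reals.

Set Implicit Arguments.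
Unset Strict Implicit.
Unset Printing Implicit Defensive.

Local Open Scope classical_set_scope.
Local Open Scope ring_scope.

(** Let N_i be the space of row vectors annihilating R_i. The N_i decrease and
    N_(i+1) is the set of l in N_i such that every l A_q is in N_i, so the chain
    is constant from the first equality N_i = N_(i+1) on; by dimension this
    occurs at i = n - 1 at the latest, hence N_(n-1) is invariant under all A_q.
    A nonzero element of N_(n-1) then annihilates all states reached from 0.
    Conversely, since the schedules span R^D and the input u = 0 is admissible,
    the span of the reached states contains the images of the B_q and is stable
    under the A_q, so it contains the column space of every R_i.
    Observability is handled dually: O_i is the transpose of the matrix R_i of
    the system (A_q^T, C_q^T), and the unobservable states form a subspace
    stable under the A_q because a word may be prefixed by any letter. *)

Import GRing.Theory.

(** * Subspaces as predicates, and linear spans *)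

Section Subspace.
Variables (F : fieldType) (V : lmodType F).

Definition subspace (P : V -> Prop) : Prop :=
  P 0 /\ forall a x y, P x -> P y -> P (a *: x + y).

Lemma subspaceZ P a x : subspace P -> P x -> P (a *: x).
Proof. by case=> P0 Plin Px; rewrite -[_ *: _]addr0; apply: Plin. Qed.

Lemma subspaceD P x y : subspace P -> P x -> P y -> P (x + y).
Proof. by case=> _ Plin Px Py; rewrite -[x]scale1r; apply: Plin. Qed.

Lemma subspace_sum P (I : finType) (f : I -> V) :
  subspace P -> (forall i, P (f i)) -> P (\sum_i f i).
Proof.
move=> Psub Pf; elim/big_ind: _ => //; first by case: Psub.
by move=> x y; apply: subspaceD.
Qed.

Lemma lin_span_sub (S : set V) (P : V -> Prop) :
  subspace P -> (forall x, S x -> P x) -> forall x, lin_span S x -> P x.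
Proof.
move=> Psub SP _ [c cS ->].
rewrite big_seq; elim/big_ind: _; first by case: Psub.
  by move=> x y; apply: subspaceD.
by move=> a /cS /SP; apply: subspaceZ.
Qed.

Lemma mem_lin_span (S : set V) x : S x -> lin_span S x.
Proof.
move=> Sx; exists [:: (1, x)]; first by move=> a; rewrite inE => /eqP ->.
by rewrite big_seq1 scale1r.
Qed.

Lemma subspace_lin_span (S : set V) : subspace (lin_span S).
Proof.
split; first by exists [::]; rewrite ?big_nil.
move=> a _ _ [c cS ->] [d dS ->].
exists ([seq (a * b.1, b.2) | b <- c] ++ d).
  by move=> b; rewrite mem_cat => /orP[/mapP[e /cS Se ->]|/dS].
rewrite big_cat big_map scaler_sumr; congr (_ + _).
by apply: eq_bigr => b _; rewrite scalerA.
Qed.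

End Subspace.

Lemma subspace_preim (F : fieldType) (V W : lmodType F) (f : {linear V -> W})
    (P : W -> Prop) : subspace P -> subspace (fun x => P (f x)).
Proof.
case=> P0 Plin; split=> [|a x y]; first by rewrite linear0.
by rewrite linearP; apply: Plin.
Qed.

(** The vectors [p] whose weighted sum lies in [P] form a subspace containing [S], hence all of F^D;
    the unit vectors then isolate each [f q]. *)
Lemma spanning_weights (F : fieldType) (V : lmodType F) (D : nat)
    (S : set 'cV[F]_D) (P : V -> Prop) (f : 'I_D -> V) :
    lin_span S = setT -> subspace P ->
    (forall p, S p -> P (\sum_q p q 0 *: f q)) ->
  forall q, P (f q).
Proof.
move=> Sspan [P0 Plin] SP q.
have Pall (p : 'cV_D) : P (\sum_q p q 0 *: f q).
  have : lin_span S p by rewrite Sspan.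
  apply: lin_span_sub SP p; split=> [|a x y Px Py].
    by rewrite big1 // => i _; rewrite mxE scale0r.
  rewrite (eq_bigr (fun i => a *: (x i 0 *: f i) + y i 0 *: f i)).
    by rewrite big_split -scaler_sumr; apply: Plin.
  by move=> i _; rewrite !mxE scalerDl scalerA.
have := Pall (delta_mx q 0); rewrite (bigD1 q) //= big1.
  by rewrite addr0 mxE !eqxx scale1r.
by move=> i iq; rewrite mxE (negbTE iq) scale0r.
Qed.

Lemma mul_mxrow_eq0 (F : fieldType) (k n D : nat) (s : 'I_D -> nat)
    (L : 'M[F]_(k, n)) (M : forall q, 'M[F]_(n, s q)) :
  L *m (\mxrow_(q < D) M q) = 0 <-> forall q, L *m M q = 0.
Proof.
rewrite mul_mxrow; split=> [/(congr1 (fun X => submxrow X))E q|E].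
  by have := congr1 (@^~ q) E; rewrite mxrowK submxrow0.
by rewrite -[RHS](@mxrow0 _ _ s); apply: eq_mxrow.
Qed.

(** * Left annihilators of the extended reachability matrices *)

Section ReachMx.
Variables (R : realType) (D r m n : nat) (Sg : alpv R D r m n).

Lemma mul_reach_mxS_eq0 k (L : 'M[R]_(k, n)) i :
  L *m reach_mx Sg i.+1 = 0 <->
  L *m reach_mx Sg i = 0 /\ forall q, L *m Amx Sg q *m reach_mx Sg i = 0.
Proof.
rewrite /= mul_mx_row; split.
  move/eqP; rewrite row_mx_eq0 => /andP[/eqP-> /eqP/mul_mxrow_eq0 E].
  by split=> // q; rewrite -mulmxA.
case=> -> E; rewrite (_ : L *m _ = 0) ?row_mx0 //.
by apply/mul_mxrow_eq0 => q; rewrite mulmxA.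
Qed.

Lemma mul_reach_mx_Bmx k (L : 'M[R]_(k, n)) i :
  L *m reach_mx Sg i = 0 -> forall q, L *m Bmx Sg q = 0.
Proof.
by elim: i => [/mul_mxrow_eq0 //|i IH /mul_reach_mxS_eq0[/IH]].
Qed.

(** Invariance of N_i under the A_q, equivalently N_i = N_(i+1), phrased for matrices [L] with rows
    in N_i. *)
Definition reach_stable i : Prop := forall k (L : 'M[R]_(k, n)),
  L *m reach_mx Sg i = 0 -> forall q, L *m Amx Sg q *m reach_mx Sg i = 0.

Lemma reach_stableS i : reach_stable i -> reach_stable i.+1.
Proof.
move=> st k L /mul_reach_mxS_eq0[_ LA] q.
by apply/mul_reach_mxS_eq0; split=> // q'; apply: st.
Qed.

(** The kernels are nested, and the rank bound compares their dimensions the other way, so they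
    coincide. *)
Lemma reach_stable_rank i :
  (\rank (reach_mx Sg i.+1) <= \rank (reach_mx Sg i))%N -> reach_stable i.
Proof.
move=> le_rank.
have sub : (kermx (reach_mx Sg i.+1) <= kermx (reach_mx Sg i))%MS.
  by apply/sub_kermxP; have /mul_reach_mxS_eq0[] := mulmx_ker (reach_mx Sg i.+1).
have bus : (kermx (reach_mx Sg i) <= kermx (reach_mx Sg i.+1))%MS.
  rewrite -(geq_leqif (mxrank_leqif_sup sub)) !mxrank_ker.
  exact: leq_sub2l.
move=> k L /sub_kermxP/submx_trans/(_ bus)/sub_kermxP.
by case/mul_reach_mxS_eq0.
Qed.

(** Until stability sets in, each step raises the rank by at least one, starting from a nonzero R_0;
    a zero R_0 is stable at once. *)
Lemma reach_stable_or_rank i :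
  reach_stable i \/ (i < \rank (reach_mx Sg i))%N.
Proof.
elim: i => [|i [/reach_stableS|]]; [|by left|].
  case: (posnP (\rank (reach_mx Sg 0))) => [/eqP|]; last by right.
  by rewrite mxrank_eq0 => /eqP E; left=> k L _ q; rewrite E mulmx0.
move=> lt_i.
case: (leqP (\rank (reach_mx Sg i.+1)) (\rank (reach_mx Sg i))).
  by left; apply/reach_stableS/reach_stable_rank.
by right; apply: leq_ltn_trans lt_i _.
Qed.

Lemma reach_stable_pred : reach_stable n.-1.
Proof.
case: (reach_stable_or_rank n.-1) => // lt_n k L /sub_kermxP.
(* In the other alternative the rank is full, so N_(n-1) is zero and trivially invariant. *)
suff /eqP-> : kermx (reach_mx Sg n.-1) == 0.
  by rewrite submx0 => /eqP-> q; rewrite !mul0mx.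
rewrite -mxrank_eq0 mxrank_ker subn_eq0.
by apply: leq_trans lt_n; apply: leqSpred.
Qed.

(** Induction on [t] with [L] varying: by stability the hypothesis passes from [L] to each L A_q,
    while L B_q vanishes because B_q is a block of R_0. *)
Lemma reach_mx_annihilates_traj p u (L : 'rV[R]_n) t :
  L *m reach_mx Sg n.-1 = 0 -> L *m traj Sg p u 0 t = 0.
Proof.
elim: t L => [|t IH] L L0; first by rewrite mulmx0.
rewrite /= mulmx_sumr big1 // => q _.
rewrite -scalemxAr mulmxDr !mulmxA (mul_reach_mx_Bmx L0) mul0mx addr0.
by rewrite IH ?scaler0 //; apply: reach_stable_pred.
Qed.

Lemma reachable_row_free : reachable Sg -> row_free (reach_mx Sg n.-1).
Proof.
move=> reach; rewrite -kermx_eq0; apply/eqP/row_matrixP => i; rewrite row0.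
set L := row i _.
have L0 : L *m reach_mx Sg n.-1 = 0 by rewrite -row_mul mulmx_ker row0.
have Lv (v : 'cV_n) : L *m v = 0.
  have : lin_span (state_map Sg 0 @` words (input_space Sg)) v by rewrite reach.
  apply: (@lin_span_sub _ _ _ (fun v => L *m v = 0)).
    split=> [|a x y Lx Ly]; first by rewrite mulmx0.
    by rewrite mulmxDr -scalemxAr Lx Ly scaler0 addr0.
  by move=> _ [w _ <-]; apply: reach_mx_annihilates_traj.
apply/rowP => k.
by have /matrixP/(_ 0 0) := Lv (delta_mx k 0); rewrite -colE !mxE.
Qed.

(** Cutting [w] along the blocks of R_i turns the product into a sum of vectors already known to lie
    in [P]. *)
Lemma subspace_reach_mx (P : 'cV[R]_n -> Prop) :
    subspace P -> (forall q u, P (Bmx Sg q *m u)) ->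
    (forall q x, P x -> P (Amx Sg q *m x)) ->
  forall i w, P (reach_mx Sg i *m w).
Proof.
move=> Psub PB PA; elim=> [|i IH] w /=.
  rewrite -[w]submxcolK mul_mxrow_mxcol.
  by apply: subspace_sum => // q; apply: PB.
rewrite -[w]vsubmxK mul_row_col -[dsubmx w]submxcolK mul_mxrow_mxcol.
apply: subspaceD => //; apply: subspace_sum => // q.
by rewrite -mulmxA; apply: PA.
Qed.

(** * Dependence of the state on the word *)

Lemma eq_traj p p' u u' x t :
    (forall s, (s < t)%N -> p s = p' s) -> (forall s, (s < t)%N -> u s = u' s) ->
  traj Sg p u x t = traj Sg p' u' x t.
Proof.
elim: t => [|t IH] //= Ep Eu.
rewrite IH => [|s st|s st]; [|exact/Ep/ltnW|exact/Eu/ltnW].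
by rewrite Ep // Eu.
Qed.

(** The state ignores the last letter of a word: [b] drives the final transition, while [a] and [c]
    only fix the lengths. *)
Lemma state_map_rcons2 x w a b c :
  state_map Sg x (rcons (rcons w b) c) =
    \sum_(q < D) b.1 q 0 *: (Amx Sg q *m state_map Sg x (rcons w a)
                             + Bmx Sg q *m b.2).
Proof.
have nth_w d d' s : (s < size w)%N ->
    nth (0, 0) (rcons (rcons w d) d') s = nth (0, 0) w s.
  by move=> sw; rewrite !nth_rcons size_rcons sw ltnS ltnW.
have nth_w1 d s : (s < size w)%N -> nth (0, 0) (rcons w d) s = nth (0, 0) w s.
  by move=> sw; rewrite nth_rcons sw.
have nth_b : nth (0, 0) (rcons (rcons w b) c) (size w) = b.
  by rewrite !nth_rcons size_rcons ltnSn ltnn eqxx.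
rewrite /state_map !size_rcons /=.
apply: eq_bigr => q _; rewrite /sched_of /input_of nth_b.
congr (_ *: (_ *m _ + _)).
by apply: eq_traj => s sw; rewrite nth_w // nth_w1.
Qed.

Lemma words_rcons (T : eqType) (X : set T) w a :
  words X (rcons w a) <-> (forall b, b \in w -> X b) /\ X a.
Proof.
split=> [[_ wX]|[wX Xa]].
  split=> [b bw|]; apply: wX; rewrite mem_rcons inE ?eqxx //.
  by rewrite bw orbT.
split; first by case: w {wX}.
by move=> b; rewrite mem_rcons inE => /orP[/eqP->|/wX].
Qed.

(** * Invariance of the span of the reached states *)

Hypothesis span_sched : lin_span (sched Sg) = setT.

Let reached := lin_span (state_map Sg 0 @` words (input_space Sg)).

Lemma reached_Bmx q u : reached (Bmx Sg q *m u).
Proof.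
apply: (spanning_weights (f := fun q => Bmx Sg q *m u) span_sched).
  exact: subspace_lin_span.
(* The first letter applies [u] at state 0; the second only advances the time. *)
move=> p Sp; apply: mem_lin_span; exists [:: (p, u); (p, u)].
  by split=> // a; rewrite !inE orbb => /eqP->.
by apply: eq_bigr => i _; rewrite mulmx0 add0r.
Qed.

Lemma reached_Amx q x : reached x -> reached (Amx Sg q *m x).
Proof.
have sub := subspace_lin_span (state_map Sg 0 @` words (input_space Sg)).
apply: (@lin_span_sub _ _ _ (fun x => reached (Amx Sg q *m x))).
  exact: (subspace_preim (mulmx (Amx Sg q))).
move=> _ [w0 + <-]; case/lastP: w0 => [[//]|w a] /words_rcons[wX Xa].
apply: (spanning_weights
  (f := fun q => Amx Sg q *m state_map Sg 0 (rcons w a)) span_sched) => //.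
(* The first (p, 0) replaces the unread letter [a] and moves the state with zero input; the second
   is unread in turn. *)
move=> p Sp; apply: mem_lin_span; exists (rcons (rcons w (p, 0)) (p, 0)).
  apply/words_rcons; split=> // b; rewrite mem_rcons inE.
  by case/orP=> [/eqP->|/wX].
rewrite (state_map_rcons2 _ _ a).
by apply: eq_bigr => i _; rewrite mulmx0 addr0.
Qed.

Lemma rank_reachable i : \rank (reach_mx Sg i) = n -> reachable Sg.
Proof.
move=> rk; have free : row_free (reach_mx Sg i) by apply/eqP.
rewrite /reachable -subTset => x _.
(* Full row rank gives a right inverse, which exhibits [x] in the column space of R_i. *)
rewrite -[x]mul1mx -(mulmxVp free) -mulmxA.
apply: subspace_reach_mx.
- exact: subspace_lin_span.
- exact: reached_Bmx.
- exact: reached_Amx.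
Qed.

End ReachMx.

(** * Duality and unobservable states *)

Section ObsMx.
Variables (R : realType) (D r m n : nat) (Sg : alpv R D r m n).

Definition dual_alpv : alpv R D m r n :=
  Alpv (sched Sg) (fun q => (Amx Sg q)^T) (fun q => (Cmx Sg q)^T)
       (fun q => (Bmx Sg q)^T).

Lemma obs_mx_dual i : obs_mx Sg i = (reach_mx dual_alpv i)^T.
Proof. by elim: i => [|i IH] //=; rewrite IH trmxK. Qed.

Definition sched_Amx (p : 'cV[R]_D) : 'M[R]_n := \sum_q p q 0 *: Amx Sg q.

Definition sched_Cmx (p : 'cV[R]_D) : 'M[R]_(r, n) := \sum_q p q 0 *: Cmx Sg q.

(** The state-transition matrix A(p(t-1)) ... A(p(0)) of the time-varying system. *)
Fixpoint trans (p : nat -> 'cV[R]_D) (t : nat) : 'M[R]_n :=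
  if t is s.+1 then sched_Amx (p s) *m trans p s else 1%:M.

(** Splits off the earliest factor, as needed when a letter is put in front of a word. *)
Lemma transSr p t : trans p t.+1 = trans (p \o succn) t *m sched_Amx (p 0%N).
Proof.
elim: t => [|t IH]; first by rewrite /= mulmx1 mul1mx.
by rewrite [LHS]/= -/(trans p t.+1) IH mulmxA.
Qed.

Lemma traj_trans p u x t :
  traj Sg p u x t = trans p t *m x + traj Sg p u 0 t.
Proof.
elim: t => [|t IH] /=; first by rewrite mul1mx addr0.
rewrite IH -mulmxA /sched_Amx mulmx_suml -big_split; apply: eq_bigr => q _ /=.
by rewrite -scalemxAl -scalerDr mulmxDr addrA.
Qed.

Definition word_obs_mx (w : seq ('cV[R]_D * 'cV[R]_m)) : 'M[R]_(r, n) :=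
  sched_Cmx (sched_of w (size w).-1) *m trans (sched_of w) (size w).-1.

Lemma output_mapE x w :
  output_map Sg x w = word_obs_mx w *m x + output_map Sg 0 w.
Proof.
rewrite /output_map /word_obs_mx /state_map traj_trans -mulmxA.
rewrite /sched_Cmx mulmx_suml -big_split; apply: eq_bigr => q _ /=.
by rewrite -scalemxAl -scalerDr mulmxDr.
Qed.

Lemma word_obs_mx_cons a w : w <> [::] ->
  word_obs_mx (a :: w) = word_obs_mx w *m sched_Amx a.1.
Proof.
case: w => // b w _.
by rewrite /word_obs_mx -mulmxA -(transSr (sched_of (a :: b :: w))).
Qed.

Definition unobservable (x : 'cV[R]_n) : Prop :=
  forall w, words (input_space Sg) w -> word_obs_mx w *m x = 0.

Lemma subspace_unobservable : subspace unobservable.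
Proof.
split=> [w _|a x y x0 y0 w Sw]; first by rewrite mulmx0.
by rewrite mulmxDr -scalemxAr x0 // y0 // scaler0 addr0.
Qed.

(** The forced response is the same from both initial states and cancels, so only their difference
    matters. *)
Lemma observable_unobservable :
  observable Sg <-> forall x, unobservable x -> x = 0.
Proof.
split=> [obs x x0|obs x1 x2 E].
  by apply: obs => w Sw; rewrite output_mapE x0 // add0r.
apply/eqP; rewrite -subr_eq0; apply/eqP/obs => w /E.
rewrite output_mapE [RHS]output_mapE => /addIr E'.
by rewrite mulmxBr E' subrr.
Qed.

Lemma sub_obs_mx_unobservable (x : 'cV[R]_n) :
  x^T *m reach_mx dual_alpv n.-1 = 0 -> unobservable x.
Proof.
move=> x0 w _; rewrite /word_obs_mx -mulmxA; move: (size w).-1 => t.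
set p := sched_of w.
(* Stability for the dual system keeps the free trajectory of [x] in the annihilator, where every
   C_q vanishes. *)
have : (trans p t *m x)^T *m reach_mx dual_alpv n.-1 = 0.
  elim: t => [|t IH] /=; first by rewrite mul1mx.
  rewrite -mulmxA /sched_Amx mulmx_suml linear_sum /= mulmx_suml big1 // => q _.
  rewrite -scalemxAl linearZ /= -scalemxAl trmx_mul.
  by rewrite [X in _ *: X](reach_stable_pred IH) scaler0.
move=> /mul_reach_mx_Bmx C0; rewrite /sched_Cmx mulmx_suml big1 // => q _.
by rewrite -scalemxAl -[Cmx Sg q]trmxK -[_ *m x]trmxK -trmx_mul C0 trmx0 scaler0.
Qed.

Lemma observable_row_free :
  observable Sg -> row_free (reach_mx dual_alpv n.-1).
Proof.
move=> /observable_unobservable obs; rewrite -kermx_eq0.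
apply/eqP/row_matrixP => i; rewrite row0; apply: trmx_inj; rewrite trmx0.
by apply/obs/sub_obs_mx_unobservable; rewrite trmxK -row_mul mulmx_ker row0.
Qed.

Hypothesis span_sched : lin_span (sched Sg) = setT.

(** One-letter words give C(p) x = 0 for every admissible [p]; spanning separates the C_q. *)
Lemma unobservable_Cmx q x : unobservable x -> Cmx Sg q *m x = 0.
Proof.
move=> x0; apply: (spanning_weights (P := fun y => y = 0)
  (f := fun q => Cmx Sg q *m x) span_sched).
  by split=> // a _ _ -> ->; rewrite scaler0 addr0.
move=> p Sp.
have : words (input_space Sg) [:: (p, 0)].
  by split=> // a; rewrite inE => /eqP->.
move=> /x0; rewrite /word_obs_mx /= mulmx1 /sched_Cmx mulmx_suml.
move=> E; rewrite -[RHS]E.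
by apply: eq_bigr => i _; rewrite -scalemxAl.
Qed.

Lemma unobservable_Amx q x : unobservable x -> unobservable (Amx Sg q *m x).
Proof.
move=> x0; apply: (spanning_weights
  (f := fun q => Amx Sg q *m x) span_sched).
  exact: subspace_unobservable.
move=> p Sp w [w0 Sw].
(* Prefixing (p, 0) makes [w] test A(p) x; the input 0 is a placeholder, as [word_obs_mx] reads only
   the schedule. *)
have /x0 : words (input_space Sg) ((p, 0) :: w).
  by split=> // a; rewrite inE => /orP[/eqP->|/Sw].
rewrite word_obs_mx_cons // -mulmxA /sched_Amx mulmx_suml => E.
rewrite -[RHS]E; congr (_ *m _); apply: eq_bigr => i _.
by rewrite -scalemxAl.
Qed.

Lemma unobservable_obs_mx i x :
  unobservable x -> x^T *m reach_mx dual_alpv i = 0.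
Proof.
elim: i x => [|i IH] x x0.
  by apply/mul_mxrow_eq0 => q; rewrite -trmx_mul unobservable_Cmx // trmx0.
apply/mul_reach_mxS_eq0; split=> [|q]; first exact: IH.
by rewrite -trmx_mul; apply/IH/unobservable_Amx.
Qed.

Lemma rank_observable i : \rank (reach_mx dual_alpv i) = n -> observable Sg.
Proof.
move=> rk; have free : row_free (reach_mx dual_alpv i) by apply/eqP.
apply/observable_unobservable => x /(unobservable_obs_mx i) x0.
by apply/trmx_inj/(row_free_inj free); rewrite x0 trmx0 mul0mx.
Qed.

End ObsMx.

Theorem theorem3 (R : realType) (D r m n : nat) (D_gt0 : (0 < D)%N)
    (r_gt0 : (0 < r)%N) (m_gt0 : (0 < m)%N) (n_gt0 : (0 < n)%N)
    (Sg : alpv R D r m n) (span_sched : lin_span (sched Sg) = setT) :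
  (reachable Sg <-> \rank (reach_mx Sg n.-1) = n) /\
  (observable Sg <-> \rank (obs_mx Sg n.-1) = n).
Proof.
split; split.
- by move/reachable_row_free/eqP.
- exact: rank_reachable.
- by rewrite obs_mx_dual mxrank_tr => /observable_row_free/eqP.
- by rewrite obs_mx_dual mxrank_tr; apply: rank_observable.
Qed.
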